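(* Consider $\min_{u\in\mathcal U}P(u)$ with $P=h+\zeta+\mu\omega_{\mathcal U}$ and $\mu=0$, and the inexact non-Hilbertian accelerated proximal gradient (APG) method (Algorithm 2 in the context) with approximation errors $\{\delta_t\}_{t\ge0}$ and weights $$\alpha_0=1,\qquad \alpha_t=(2t+3)/4\quad(t\ge1).$$ Then for all $t\ge0$, $$P(z_t)-P^*\le\frac{4\bar L\,D_{\omega_{\mathcal U}}(u^*,u_0)}{(t+2)^2}+\frac{\sum_{i=0}^t(i+2)^2\delta_i}{(t+2)^2}.$$ In addition, suppose $h$ has the max-structure $h(u)=\max_{v\in\mathcal V}\bar\Psi(u,v)$ described in the context, $\mathcal U$ is bounded, and $(\hat h(u_t),\hat\nabla h(u_t))=(\bar\Psi(u_t,v_t),\nabla_u\bar\Psi(u_t,v_t))$ for all $t\ge0$, where $v_t\in\mathcal V$ satisfies $h(u_t)-\bar\Psi(u_t,v_t)\le\delta_t/2$. Then one can choose $\bar L=2L_h$ and obtain, for all $t\ge0$, $$\bar\Delta(z_t,\bar v_t)\le\frac{8L_h\,\Omega_{\omega_{\mathcal U}}(u_0)}{(t+2)^2}+\frac{\sum_{i=0}^t(i+2)^2\delta_i}{(t+2)^2},$$ where $\bar v_t:=A_t^{-1}\sum_{i=0}^t\alpha_iv_i$ and $\Omega_{\omega_{\mathcal U}}(u_0):=\max_{u\in\mathcal U}D_{\omega_{\mathcal U}}(u,u_0)<+\infty$.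
   Context: Setting. $\mathbb U$ is a finite-dimensional real normed space (dual norm $\|\cdot\|_*$) and $\mathcal U\subseteq\mathbb U$ is nonempty, closed, convex. A distance generating function (DGF) on $\mathcal U$ is $\omega_{\mathcal U}:\mathbb U\to\mathbb R\cup\{+\infty\}$ that is continuous and 1-strongly convex on $\mathcal U$ and essentially smooth (continuously differentiable on $\operatorname{int}\operatorname{dom}\omega_{\mathcal U}$, with $\|\nabla\omega_{\mathcal U}(u_k)\|_*\to+\infty$ whenever $u_k\in\operatorname{int}\operatorname{dom}\omega_{\mathcal U}$ converges to a boundary point of $\operatorname{dom}\omega_{\mathcal U}$). $\mathcal U^o:=\mathcal U\cap\operatorname{int}\operatorname{dom}\omega_{\mathcal U}$ and $D_{\omega_{\mathcal U}}(u',u):=\omega_{\mathcal U}(u')-\omega_{\mathcal U}(u)-\langle\nabla\omega_{\mathcal U}(u),u'-u\rangle$. $P^*:=\min_{u\in\mathcal U}\{P(u):=h(u)+\zeta(u)+\mu\omega_{\mathcal U}(u)\}$, $\mu\ge0$, where $h,\zeta$ are convex on $\mathcal U$; $h$ is differentiable on an open set $\mathcal U'\supseteq\mathcal U$ with $\nabla h$ $L_h$-Lipschitz on $\mathcal U$; $\zeta:\mathbb U\to\mathbb R\cup\{+\infty\}$ is closed and for all $\xi\in\mathbb U^*$, $\alpha>0$ the problem $\min_{u\in\mathcal U}\zeta(u)+\langle\xi,u\rangle+\alpha^{-1}\omega_{\mathcal U}(u)$ has a unique (easily computable) solution in $\mathcal U^o\cap\operatorname{dom}\zeta$. An optimal solution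 $u^*\in\mathcal U^o$ exists. Inexact model. $(\hat h(u),\hat\nabla h(u))\in\mathbb R\times\mathbb U^*$ is a $(\delta,\bar L)$-FOA of $h$ at $u\in\mathcal U$ if for all $u'\in\mathcal U$: $\hat h(u)+\langle\hat\nabla h(u),u'-u\rangle\le h(u')\le\hat h(u)+\langle\hat\nabla h(u),u'-u\rangle+(\bar L/2)\|u'-u\|^2+\delta$. Max-structure. $h(u)=\max_{v\in\mathcal V}\bar\Psi(u,v)$ for $u\in\mathcal U'$, where $\mathcal V$ is a nonempty compact convex subset, contained in an open set $\mathcal V'$, of a finite-dimensional normed space; $\bar\Psi:\mathcal U'\times\mathcal V'\to\mathbb R$ is jointly continuous; for $v\in\mathcal V$, $\bar\Psi(\cdot,v)$ is convex on $\mathcal U$ and differentiable on $\mathcal U'$, with $\|\nabla_u\bar\Psi(u,v)-\nabla_u\bar\Psi(u',v)\|_*\le L_{uu}\|u-u'\|$ and $\|\nabla_u\bar\Psi(u,v)-\nabla_u\bar\Psi(u,v')\|_*\le L_{uv}\|v-v'\|$ for $u,u'\in\mathcal U$, $v,v'\in\mathcal V$; $\bar\Psi(u,\cdot)$ is $\rho$-strongly concave on $\mathcal V$ for $u\in\mathcal U$, $\rho>0$. In this case $L_h:=L_{uu}+L_{uv}^2/\rho$. Dual function: $\Xi(v):=\inf_{u\in\mathcal U}\bar\Psi(u,v)+\zeta(u)+\mu\omega_{\mathcal U}(u)$; duality gap: $\bar\Delta(u,v):=P(u)-\Xi(v)$. Algorithm 2. Input: errors $\delta_t\ge0$, $\bar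 L\ge L_h$, weights $\alpha_t$; $A_t:=\sum_{i=0}^t\alpha_i$, $\tau_t:=\alpha_t/A_t$. Start: $u_0\in\mathcal U^o$, $s_0=\hat\nabla h(u_0)$ with $(\hat h(u_0),\hat\nabla h(u_0))$ a $(\delta_0,\bar L)$-FOA of $h$ at $u_0$, $z_0=\arg\min_{u\in\mathcal U}\langle s_0,u\rangle+\zeta(u)+\mu\omega_{\mathcal U}(u)+\bar LD_{\omega_{\mathcal U}}(u,u_0)$. For $t=0,1,\dots$: $\bar u_{t+1}=\arg\min_{u\in\mathcal U}\langle s_t,u\rangle+A_t(\zeta(u)+\mu\omega_{\mathcal U}(u))+\bar LD_{\omega_{\mathcal U}}(u,u_0)$; $u_{t+1}=(1-\tau_{t+1})z_t+\tau_{t+1}\bar u_{t+1}$; compute a $(\delta_{t+1},\bar L)$-FOA $(\hat h(u_{t+1}),\hat\nabla h(u_{t+1}))$ of $h$ at $u_{t+1}$; $s_{t+1}=s_t+\alpha_{t+1}\hat\nabla h(u_{t+1})$; $w_{t+1}=\arg\min_{u\in\mathcal U}\alpha_{t+1}(\langle\hat\nabla h(u_{t+1}),u\rangle+\zeta(u)+\mu\omega_{\mathcal U}(u))+(A_t\mu+\bar L)D_{\omega_{\mathcal U}}(u,\bar u_{t+1})$; $z_{t+1}=(1-\tau_{t+1})z_t+\tau_{t+1}w_{t+1}$. *)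

(* Defs.v *)
From HB Require Import structures.
From mathcomp Require Import all_boot all_order all_algebra.
From mathcomp Require Import all_classical all_reals all_analysis.
Set Implicit Arguments.
Unset Strict Implicit.
Unset Printing Implicit Defensive.
Import Order.TTheory GRing.Theory Num.Theory.
Import numFieldNormedType.Exports.
Local Open Scope classical_set_scope.
Local Open Scope ring_scope.

#[short(type="finNormedModType")]
HB.structure Definition FinNormedModule (R : realType) :=
  {E of NormedModule R E & Vector R E}.

Section Convexity.
Context {R : realType}.

Definition strongly_convex_on (E : normedModType R) (rho : R) (A : set E)
    (f : E -> R) :=
  forall x y (t : R), A x -> A y -> 0 <= t <= 1 ->
    f (t *: x + (1 - t) *: y) <=
      t * f x + (1 - t) * f y - rho / 2 * (t * (1 - t) * `|x - y| ^+ 2).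

Definition strongly_concave_on (E : normedModType R) (rho : R) (A : set E)
    (f : E -> R) := strongly_convex_on rho A (fun x => - f x).

(* Convexity of a function with values in R u {+oo}: the product 0 * +oo, which
   is 0 in \bar R, arises only at t = 0 and t = 1, where it is harmless. *)
Definition econvex_on (E : normedModType R) (A : set E) (f : E -> \bar R) :=
  forall x y (t : R), A x -> A y -> 0 <= t <= 1 ->
    (f (t *: x + (1 - t) *: y)%R <= t%:E * f x + (1 - t)%:E * f y)%E.

Definition edom (T : Type) (f : T -> \bar R) : set T :=
  [set x | (f x < +oo)%E].

Definition is_argmin (T : Type) (A : set T) (f : T -> \bar R) (x : T) :=
  A x /\ forall y, A y -> (f x <= f y)%E.

Definition is_max (T : Type) (A : set T) (f : T -> R) (m : R) :=
  (exists2 x, A x & f x = m) /\ forall x, A x -> f x <= m.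

End Convexity.

Section Gradient.
Context {R : realType} {E : finNormedModType R}.

Definition dual_norm (xi : 'Hom(E, R^o)) : R :=
  sup [set `|xi u| | u in [set u : E | `|u| <= 1]].

(* The gradient, as an element of the dual space; it is meaningful only at
   points where f is differentiable. *)
Definition grad (f : E -> R) (u : E) : 'Hom(E, R^o) := linfun ('d f u).

Definition grad_lipschitz_on (A : set E) (f : E -> R) (L : R) :=
  forall u u', A u -> A u' ->
    dual_norm (grad f u - grad f u') <= L * `|u - u'|.

(* (hh, gh) is a (delta, L)-FOA of h at u. *)
Definition is_FOA (U : set E) (h : E -> R) (delta L : R) (u : E)
    (hh : R) (gh : 'Hom(E, R^o)) :=
  forall u', U u' ->
    hh + gh (u' - u) <= h u' <=
      hh + gh (u' - u) + L / 2 * `|u' - u| ^+ 2 + delta.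

End Gradient.

Section DistanceGeneratingFunction.
Context {R : realType} {E : finNormedModType R}.
Variables (U : set E) (omega : E -> \bar R).

Definition egrad (u : E) : 'Hom(E, R^o) := grad (fine \o omega) u.

(* The second conjunct is the continuity of the gradient for the dual norm. *)
Definition essentially_smooth :=
  [/\ forall u, (edom omega)° u -> differentiable (fine \o omega : E -> R) u,
      forall u, (edom omega)° u -> forall e : R, 0 < e ->
        \forall u' \near u, dual_norm (egrad u' - egrad u) < e
    & forall (u_ : nat -> E) (u : E), (forall k, (edom omega)° (u_ k)) ->
        u_ @ \oo --> u -> (closure (edom omega) `\` (edom omega)°) u ->
        dual_norm (egrad (u_ k)) @[k --> \oo] --> +oo].

(* Continuity on U is that of a real-valued function: omega is finite on U. *)
Definition is_dgf :=
  [/\ forall u, (-oo < omega u)%E,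
      U `<=` edom omega,
      {within U, continuous (fine \o omega)},
      strongly_convex_on 1 U (fine \o omega)
    & essentially_smooth].

Definition dgf_int : set E := U `&` (edom omega)°.

Definition bregman (u' u : E) : \bar R :=
  (omega u' - omega u - (egrad u (u' - u)%R)%:E)%E.

Definition dgf_radius (u0 : E) : \bar R :=
  ereal_sup [set bregman u u0 | u in U].

(* zeta is closed, convex on U, and its prox-type problems are uniquely
   solvable, with solution in dgf_int and in dom zeta. *)
Definition is_simple (zeta : E -> \bar R) :=
  [/\ forall u, (-oo < zeta u)%E,
      lower_semicontinuous zeta,
      econvex_on U zeta
    & forall (xi : 'Hom(E, R^o)) (alpha : R), 0 < alpha ->
        exists u, let prox :=
            is_argmin U
              (fun u => zeta u + (xi u)%:E + (alpha^-1)%:E * omega u)%E in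
          [/\ prox u, dgf_int u, edom zeta u
            & forall u', prox u' -> u' = u]].

Variables (zeta : E -> \bar R) (mu : R).

Definition objective (h : E -> R) (u : E) : \bar R :=
  ((h u)%:E + zeta u + mu%:E * omega u)%E.

Definition opt_value (h : E -> R) : \bar R :=
  ereal_inf [set objective h u | u in U].

Definition dual_function (F : Type) (Psi : E -> F -> R) (v : F) : \bar R :=
  ereal_inf [set objective (Psi^~ v) u | u in U].

Definition duality_gap (h : E -> R) (F : Type) (Psi : E -> F -> R)
    (u : E) (v : F) : \bar R :=
  (objective h u - dual_function Psi v)%E.

Definition weight_sum (alpha : nat -> R) (t : nat) : R :=
  \sum_(i < t.+1) alpha i.

Definition weight_ratio (alpha : nat -> R) (t : nat) : R :=
  alpha t / weight_sum alpha t.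

(* The iterates of the accelerated proximal gradient method, run with the
   gradient estimates ghat t of h at u t; that these are FOAs is stated
   separately. The values ubar 0 and w 0 are not used. *)
Record apg_iterates (Lbar : R) (alpha : nat -> R) (ghat s : nat -> 'Hom(E, R^o))
    (u ubar w z : nat -> E) : Prop := {
  apg_u0 : dgf_int (u 0%N);
  apg_s0 : s 0%N = ghat 0%N;
  apg_z0 : is_argmin U
    (fun x => (s 0%N x)%:E + zeta x + mu%:E * omega x
              + Lbar%:E * bregman x (u 0%N))%E (z 0%N);
  apg_ubar : forall t, is_argmin U
    (fun x => (s t x)%:E
              + (weight_sum alpha t)%:E * (zeta x + mu%:E * omega x)
              + Lbar%:E * bregman x (u 0%N))%E (ubar t.+1);
  apg_u : forall t, u t.+1 =
    (1 - weight_ratio alpha t.+1) *: z t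
    + weight_ratio alpha t.+1 *: ubar t.+1;
  apg_s : forall t, s t.+1 = s t + alpha t.+1 *: ghat t.+1;
  apg_w : forall t, is_argmin U
    (fun x => (alpha t.+1)%:E * ((ghat t.+1 x)%:E + zeta x + mu%:E * omega x)
              + (weight_sum alpha t * mu + Lbar)%:E
                * bregman x (ubar t.+1))%E (w t.+1);
  apg_z : forall t, z t.+1 =
    (1 - weight_ratio alpha t.+1) *: z t + weight_ratio alpha t.+1 *: w t.+1
}.

End DistanceGeneratingFunction.

Record max_structure (R : realType) (E F : finNormedModType R)
    (U U' : set E) (V V' : set F) (h : E -> R) (Psi : E -> F -> R)
    (rho Luu Luv : R) : Prop := {
  ms_V0 : V !=set0;
  ms_Vcompact : compact V;
  ms_Vconvex : convex_set V;
  ms_V'open : open V';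
  ms_VV' : V `<=` V';
  ms_max : forall u, U' u -> is_max V (Psi u) (h u);
  ms_cont : {within U' `*` V', continuous (fun p => Psi p.1 p.2)};
  ms_convex : forall v, V v -> convex_function U (Psi^~ v);
  ms_diff : forall v, V v -> forall u, U' u ->
    differentiable (Psi^~ v : E -> R) u;
  ms_Luu0 : 0 <= Luu;
  ms_Luu : forall v, V v -> grad_lipschitz_on U (Psi^~ v) Luu;
  ms_Luv0 : 0 <= Luv;
  ms_Luv : forall u v v', U u -> V v -> V v' ->
    dual_norm (grad (Psi^~ v) u - grad (Psi^~ v') u) <= Luv * `|v - v'|;
  ms_rho0 : 0 < rho;
  ms_concave : forall u, U u -> strongly_concave_on rho V (Psi u)
}.

(* Main.v *)
Require Import Defs.
From HB Require Import structures.
From mathcomp Require Import all_boot all_order all_algebra.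
From mathcomp Require Import all_classical all_reals all_analysis.
From mathcomp Require Import ring lra.
Import Order.TTheory GRing.Theory Num.Theory.
Import numFieldNormedType.Exports.
Local Open Scope classical_set_scope.
Local Open Scope ring_scope.

Set Implicit Arguments.
Unset Strict Implicit.
Unset Printing Implicit Defensive.

(** The proof is an estimate sequence argument. Each gradient query yields the
affine minorant hhat_i + <ghat_i, x - u_i> of h, and their weighted sum, plus
the matching multiple of zeta, is [lower_model]. The invariant [apg_estimate]
says that A_t P(z_t) is at most lower_model t x + Lbar D(x, u_0), for every
feasible x, up to the accumulated error \sum_i A_i delta_i.

The point ubar_(t+1) minimises the right-hand side, so strong convexity in the
Bregman sense ([three_point]) leaves room for a term Lbar D(x, ubar_(t+1)).
That term is the one that w_(t+1) is designed to absorb. Since u_(t+1) and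
z_(t+1) differ by tau (w_(t+1) - ubar_(t+1)), the quadratic upper model of h
at u_(t+1) costs A_(t+1) tau^2 (Lbar/2) |w_(t+1) - ubar_(t+1)|^2. This is at
most Lbar D(w_(t+1), ubar_(t+1)) because omega is 1-strongly convex and
alpha_(t+1)^2 <= A_(t+1). No inner product is used, which is why the method
works for an arbitrary norm. The weights sum to A_t = (t+2)^2/4, whence the
rate.

For the primal bound, each minorant is at most h, and the invariant is read at
x = ustar. For the duality gap, each minorant is at most Psi(x, v_i), and
concavity in v ([weighted_mean_concave]) replaces the weighted mean of the
Psi(x, v_i) by Psi(x, vbar_t); the invariant then holds for all x at once, and
D(x, u_0) is bounded by its maximum over U, which is attained by compactness
in finite dimension ([fin_bounded_closed_compact]).

That the approximate maximiser v_t yields an inexact oracle is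
[max_structure_FOA]: strong concavity of Psi(u, .) turns near-optimality in
value into proximity to the exact maximiser, and Young's inequality trades
this distance against |u' - u|^2. *)

(** * Convexity in terms of real weights *)

Lemma convex_setE (R : realType) (E : lmodType R) (A : set E) :
  convex_set A -> forall x y (t : R), A x -> A y -> 0 <= t <= 1 ->
    A (t *: x + (1 - t) *: y).
Proof.
move=> cA x y t Ax Ay /andP[t0 t1].
have := cA x y (Itv01 t0 t1) (mem_set Ax) (mem_set Ay).
by move/set_mem.
Qed.

Lemma convex_functionE (R : realType) (E : lmodType R) (A : set E)
    (f : E -> R) :
  convex_function A f -> forall x y (t : R), A x -> A y -> 0 <= t <= 1 ->
    f (t *: x + (1 - t) *: y) <= t * f x + (1 - t) * f y.
Proof.
move=> cf x y t Ax Ay /andP[t0 t1].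
exact: (cf (Itv01 t0 t1) x y (mem_set Ax) (mem_set Ay)).
Qed.

(** * Gradients and one-sided difference quotients *)

Section Gradient.
Context {R : realType} {E : finNormedModType R}.
Implicit Types (f : E -> R) (u x d : E).

Lemma gradE f u d : grad f u d = 'd f u d.
Proof. by rewrite /grad lfunE. Qed.

Lemma cvg_grad f u d : differentiable f u ->
  l^-1 * (f (u + l *: d) - f u) @[l --> 0^'+] --> grad f u d.
Proof.
move=> df; rewrite gradE -deriveE //.
have := cvg_dnbhs_at_right (diff_derivable (v := d) df).
rewrite -/(derive f u d); apply: cvg_trans; apply: near_eq_cvg.
by near=> l; rewrite /GRing.scale /= [_ *: _ + _]addrC.
Unshelve. all: by end_near. Qed.

Lemma cvg_affine_at_right (b c : R) : b + l * c @[l --> 0^'+] --> b.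
Proof.
rewrite -[X in _ --> X]addr0 -[X in _ --> _ + X](mul0r c).
apply: cvgD; first exact: cvg_cst.
apply: cvgM; last exact: cvg_cst.
by apply: cvg_at_right_filter; exact: cvg_id.
Qed.

(** A first-order bound on the difference quotient suffices: the correction
l * c, which strong convexity produces, vanishes as l tends to 0. *)
Lemma grad_le f u d (b c : R) : differentiable f u ->
  (forall l, 0 < l <= 1 -> f (u + l *: d) - f u <= l * (b + l * c)) ->
  grad f u d <= b.
Proof.
move=> df fb.
apply: (ler_cvg_to (cvg_grad (d := d) df) (@cvg_affine_at_right b c)).
near=> l.
have l0 : 0 < l by near: l; exact: nbhs_right_gt.
have l1 : l <= 1 by near: l; apply: nbhs_right_le; exact: ltr01.
by rewrite ler_pdivrMl // fb // l0.
Unshelve. all: by end_near. Qed.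

Lemma grad_ge f u d (b : R) : differentiable f u ->
  (forall l, 0 < l <= 1 -> l * b <= f (u + l *: d) - f u) ->
  b <= grad f u d.
Proof.
move=> df fb; apply: (cvgr_to_ge (cvg_grad (d := d) df)).
near=> l.
have l0 : 0 < l by near: l; exact: nbhs_right_gt.
have l1 : l <= 1 by near: l; apply: nbhs_right_le; exact: ltr01.
by rewrite ler_pdivlMl // fb // l0.
Unshelve. all: by end_near. Qed.

Lemma grad_convex_le f (U : set E) u x : differentiable f u ->
  convex_function U f -> U u -> U x -> f u + grad f u (x - u) <= f x.
Proof.
move=> df /convex_functionE cf Uu Ux; rewrite -lerBrDl.
apply: (grad_le (c := 0) df) => l /andP[l0 l1].
have -> : u + l *: (x - u) = l *: x + (1 - l) *: u.
  by rewrite scalerBr scalerBl scale1r addrCA addrC.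
have := cf x u l Ux Uu; rewrite (ltW l0) l1 => /(_ isT); lra.
Qed.

(** Continuity guarantees that the supremum defining the dual norm is that of
a bounded set; otherwise [sup] would return a default value. *)
Lemma dual_normP (xi : 'Hom(E, R^o)) (d : E) :
  continuous (xi : E -> R) -> xi d <= dual_norm xi * `|d|.
Proof.
move=> cxi.
have [d0|d0] := eqVneq d 0; first by rewrite d0 linear0 normr0 mulr0.
have nd : 0 < `|d| by rewrite normr_gt0.
rewrite -ler_pdivrMr //; apply: (le_trans (ler_norm _)).
apply: ub_le_sup; last first.
  exists (`|d|^-1 *: d) => /=.
    by rewrite normrZ ger0_norm ?invr_ge0 // mulVf ?normr_eq0.
  by rewrite linearZ /= [_ *: _]mulrC.
have /linear_boundedP/pinfty_ex_gt0[M M0 hM] :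
    bounded_near (xi : E -> R^o) (nbhs 0).
  exact/linear_bounded_continuous.
exists M => _ [y /= y1 <-]; apply: (le_trans (hM y)).
by rewrite ler_piMr // ltW.
Qed.

End Gradient.

(** * Compactness in finite-dimensional normed spaces *)

Section HeineBorel.
Context {R : realType} {E : finNormedModType R}.
Import VectorInternalTheory.

Lemma r2v_continuous : continuous (r2v : 'rV[R]_(dim E) -> E).
Proof.
have -> : (r2v : 'rV[R]_(dim E) -> E) =
    fun x => \sum_(i < dim E) x ord0 i *: r2v (delta_mx 0 i).
  apply/funext => x; rewrite {1}[x]row_sum_delta linear_sum.
  by apply: eq_bigr => i _; rewrite linearZ.
apply: continuous_big => [p|i _ x]; first exact: add_continuous.
apply: (@cvgZr_tmp _ _ _ (nbhs x)). 
 have := @coord_continuous R 1 (dim E) 0 i x. done.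
Qed.

(** Equivalence of norms: the image of the unit sphere of the coordinate space
is compact and avoids 0. *)
Lemma r2v_lower_bound : exists2 c : R, 0 < c &
  forall x : 'rV[R]_(dim E), c * `|x| <= `|r2v x : E|.
Proof.
pose K := [set x : 'rV[R]_(dim E) | `|x| = 1].
(* The sphere is empty exactly in dimension 0. *)
have [K0|/set0P K0] := eqVneq K set0.
  exists 1 => // x; have [->|x0] := eqVneq x 0.
    by rewrite linear0 !normr0 mulr0.
  suff : K (`|x|^-1 *: x) by rewrite K0.
  by rewrite /K /= normrZ ger0_norm ?invr_ge0 // mulVf ?normr_eq0.
have cK : compact K.
  apply: bounded_closed_compact.
    exists 1; split; first exact: real1.
    by move=> M M1 x /= ->; exact: ltW.
  have /continuous_closedP := @norm_continuous _ 'rV[R]_(dim E).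
  by move=> /(_ [set x | x = 1]); apply; exact: closed_eq.
have [|x0 /set_mem x0K xmin] :=
    @compact_EVT_min _ _ (fun x : 'rV[R]_(dim E) => `|r2v x : E|) K K0 cK.
  apply: continuous_subspaceT => x; apply: (@cvg_norm _ _ _ (nbhs x)).
  exact: (@r2v_continuous x).
exists `|r2v x0 : E|.
  rewrite normr_gt0; apply/eqP => /(congr1 v2r); rewrite r2vK linear0 => x00.
  by move: x0K; rewrite /K /= x00 normr0 => /esym/eqP; rewrite oner_eq0.
move=> x; have [->|xn0] := eqVneq x 0.
  by rewrite linear0 !normr0 mulr0.
have nx : 0 < `|x| by rewrite normr_gt0.
rewrite -ler_pdivlMr //.
have := xmin (`|x|^-1 *: x); rewrite linearZ normrZ ger0_norm ?invr_ge0 //.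
rewrite mulrC; apply; apply/mem_set.
by rewrite /K /= normrZ ger0_norm ?invr_ge0 // mulVf ?normr_eq0.
Qed.

Lemma fin_bounded_closed_compact (A : set E) :
  bounded_set A -> closed A -> compact A.
Proof.
move=> [M [Mreal MA]] Acl; have [c c0 cP] := r2v_lower_bound.
have -> : A = r2v @` (r2v @^-1` A).
  rewrite eqEsubset; split=> [y Ay|_ [x /= Ax <-] //].
  by exists (v2r y) => /=; rewrite v2rK.
apply: continuous_compact.
  exact/continuous_subspaceT/r2v_continuous.
apply: bounded_closed_compact; last first.
  by have /continuous_closedP := r2v_continuous; exact.
exists (c^-1 * (`|M| + 1)); split; first exact: num_real.
move=> r rM x /= Ax; apply: le_trans (ltW rM).
rewrite ler_pdivlMl //; apply: le_trans (cP x) _; apply: MA => //.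
by rewrite (le_lt_trans (ler_norm M)) // ltrDl.
Qed.

End HeineBorel.

(** * The oracle given by an approximate maximiser *)

Lemma le_of_le_onem (R : realFieldType) (a b : R) :
  (forall t, 0 < t <= 1 -> (1 - t) * a <= b) -> a <= b.
Proof.
move=> ab; have b0 : 0 <= b.
  by have := ab 1; rewrite ltr01 lexx => /(_ isT); lra.
rewrite leNgt; apply/negP => ba.
have a0 : 0 < a by exact: le_lt_trans ba.
have a2 : 0 < 2 * a by lra.
have := ab ((a - b) / (2 * a)); rewrite divr_gt0 ?subr_gt0 //=.
rewrite ler_pdivrMr // mul1r => /(_ ltac:(lra)).
have -> : (1 - (a - b) / (2 * a)) * a = (a + b) / 2 by field; lra.
lra.
Qed.

(** Compare vmax with t v + (1 - t) vmax, divide by t, and let t tend to 0. *)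
Lemma strongly_concave_max (R : realType) (F : finNormedModType R) (rho : R)
    (V : set F) (f : F -> R) (vmax v : F) :
  convex_set V -> strongly_concave_on rho V f -> V vmax -> V v ->
  (forall y, V y -> f y <= f vmax) ->
  f v + rho / 2 * `|v - vmax| ^+ 2 <= f vmax.
Proof.
move=> /convex_setE cV cf Vm Vv fmax; rewrite -lerBrDl.
apply: le_of_le_onem => t /andP[t0 t1].
have t01 : 0 <= t <= 1 by rewrite (ltW t0).
have fy := fmax _ (cV v vmax t Vv Vm t01).
have cfy := cf v vmax t Vv Vm t01.
rewrite -(ler_pM2l t0); lra.
Qed.

Lemma young_ineq (R : realFieldType) (rho c x y : R) : 0 < rho ->
  c * x * y <= rho / 2 * x ^+ 2 + c ^+ 2 / rho / 2 * y ^+ 2.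
Proof.
move=> r0; rewrite -subr_ge0.
have -> : rho / 2 * x ^+ 2 + c ^+ 2 / rho / 2 * y ^+ 2 - c * x * y =
  (rho * x - c * y) ^+ 2 / (2 * rho) by field; lra.
by rewrite divr_ge0 ?sqr_ge0 // mulr_ge0 // ltW.
Qed.

Section MaxStructure.
Context {R : realType} {E : finNormedModType R}.

Lemma grad_continuous (f : E -> R) (u : E) :
  differentiable f u -> continuous (grad f u : E -> R).
Proof.
move=> df; have -> : (grad f u : E -> R) = 'd f u.
  by apply/funext => d; rewrite gradE.
exact: diff_continuous.
Qed.

Lemma gradB_le (f g : E -> R) (u v d : E) (M : R) :
  differentiable f u -> differentiable g v ->
  dual_norm (grad f u - grad g v) <= M ->
  grad f u d <= grad g v d + M * `|d|.
Proof.
move=> df dg fgM.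
have := @dual_normP _ _ (grad f u - grad g v) d.
rewrite add_lfunE opp_lfunE -lerBlDl => fgd.
apply: (le_trans (fgd _)); last by rewrite ler_wpM2r.
have -> : ((grad f u - grad g v) : E -> R) = grad f u \- grad g v.
  by apply/funext => y; rewrite add_lfunE opp_lfunE.
move=> x; apply: (@cvgB _ _ _ (nbhs x)); exact: grad_continuous.
Qed.

(** The constant L is twice that of the classical descent lemma, but no
integration along the segment is needed: convexity bounds the increment by the
gradient at u', and the Lipschitz condition moves the gradient to u. *)
Lemma convex_descent (U : set E) (f : E -> R) (L : R) (u u' : E) :
  convex_function U f -> (forall x, U x -> differentiable f x) ->
  grad_lipschitz_on U f L -> U u -> U u' ->
  f u' <= f u + grad f u (u' - u) + L * `|u' - u| ^+ 2.
Proof.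
move=> cf df lf Uu Uu'.
have := grad_convex_le (df _ Uu') cf Uu' Uu.
rewrite -[u - u']opprB linearN /=.
have := gradB_le (u' - u) (df _ Uu') (df _ Uu) (lf _ _ Uu' Uu).
rewrite -mulrA -expr2.
move: (grad f u' (u' - u)) (grad f u (u' - u)) => gu' gu *; lra.
Qed.

(** With v' and vu the exact maximisers at u' and u, the gradient at v' is
replaced by the one at v, at the cost Luv |v' - v| |u' - u|. Splitting
|v' - v| through vu, Young's inequality pays for both parts with the strong
concavity gaps of v' and v at u; the gap of v is at most delta / 2. *)
Lemma max_structure_FOA (F : finNormedModType R) (U U' : set E) (V V' : set F)
    (h : E -> R) (Psi : E -> F -> R) (rho Luu Luv delta : R) (u : E) (v : F) :
  U `<=` U' -> max_structure U U' V V' h Psi rho Luu Luv ->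
  U u -> V v -> h u - Psi u v <= delta / 2 ->
  is_FOA U h delta (2 * (Luu + Luv ^+ 2 / rho)) u (Psi u v)
    (grad (Psi^~ v) u).
Proof.
move=> UU' [V0 _ cV _ _ hmax _ cPsi dPsi Luu0 lPsi Luv0 lgrad rho0 concave].
move=> Uu Vv hdelta u' Uu'.
have dPsiU y : V y -> forall x, U x -> differentiable (Psi^~ y : E -> R) x.
  by move=> Vy x Ux; apply: dPsi => //; exact: UU'.
have [_ hle'] := hmax _ (UU' _ Uu').
apply/andP; split.
  apply: le_trans (hle' _ Vv).
  exact: (grad_convex_le (dPsiU _ Vv _ Uu) (cPsi _ Vv) Uu Uu').
have [[v' Vv' hv'] _] := hmax _ (UU' _ Uu').
have [[vu Vvu hvu] hle] := hmax _ (UU' _ Uu).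
have desc := convex_descent (cPsi _ Vv') (dPsiU _ Vv') (lPsi _ Vv') Uu Uu'.
have gdiff := gradB_le (u' - u) (dPsiU _ Vv' _ Uu) (dPsiU _ Vv _ Uu)
  (lgrad u v' v Uu Vv' Vv).
have conc y (Vy : V y) : Psi u y + rho / 2 * `|y - vu| ^+ 2 <= h u.
  rewrite -hvu; apply: strongly_concave_max cV (concave _ Uu) Vvu Vy _.
  by move=> x Vx; rewrite hvu; exact: hle.
have c1 := conc _ Vv'; have c2 := conc _ Vv.
have y1 := young_ineq Luv `|v' - vu| `|u' - u| rho0.
have y2 := young_ineq Luv `|v - vu| `|u' - u| rho0.
have tri : Luv * `|v' - v| * `|u' - u| <=
    Luv * (`|v' - vu| + `|v - vu|) * `|u' - u|.
  rewrite ler_wpM2r // ler_wpM2l //.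
  have -> : v' - v = (v' - vu) - (v - vu) by rewrite opprB addrA subrK.
  exact: ler_normB.
move: desc gdiff c1 c2 y1 y2 tri hdelta; rewrite -hv'.
move: (grad (Psi^~ v') u (u' - u)) (grad (Psi^~ v) u (u' - u)) => gv' gv.
move: (Psi u' v') (Psi u v') (Psi u v) (h u) => Pu'v' Puv' Puv hu.
move: `|v' - v| `|v' - vu| `|v - vu| `|u' - u| => nv'v nv'vu nvvu nu.
move=> *; lra.
Qed.

End MaxStructure.

(** * Bregman proximal steps *)

Section ProxStep.
Context {R : realType} {E : finNormedModType R}.
Variables (U : set E) (omega zeta : E -> \bar R).
Hypotheses (Uconvex : convex_set U) (homega : is_dgf U omega).
Hypothesis hzeta : is_simple U omega zeta.

(** On these points omega and zeta are both finite, so that all the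
inequalities below can be stated between real numbers. *)
Definition feasible : set E := U `&` edom zeta.

Definition rbregman (x u : E) : R :=
  fine (omega x) - fine (omega u) - egrad omega u (x - u).

Lemma fineK_dgf x : U x -> (fine (omega x))%:E = omega x.
Proof.
case: homega => gtNy Udom _ _ _ Ux; apply: fineK.
by rewrite fin_real // gtNy; exact: Udom.
Qed.

Lemma fineK_feasible x : feasible x -> (fine (zeta x))%:E = zeta x.
Proof.
by case: hzeta => gtNy _ _ _ [_ zx]; rewrite fineK // fin_real // gtNy.
Qed.

Lemma notin_edom x : ~ edom zeta x -> zeta x = +oo%E.
Proof. by move=> /negP; rewrite -leNgt leye_eq => /eqP. Qed.

Lemma bregmanE x u : U x -> U u -> bregman omega x u = (rbregman x u)%:E.
Proof. by move=> Ux Uu; rewrite /bregman -(fineK_dgf Ux) -(fineK_dgf Uu). Qed.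

(** Any solution of a prox problem is a feasible point. *)
Lemma feasible_nonempty : feasible !=set0.
Proof.
case: hzeta => _ _ _ /(_ 0 1 ltr01)[u [[Uu _] _ zu _]].
by exists u.
Qed.

Lemma feasible_convex x y (t : R) : feasible x -> feasible y -> 0 <= t <= 1 ->
  feasible (t *: x + (1 - t) *: y) /\
  fine (zeta (t *: x + (1 - t) *: y)) <=
    t * fine (zeta x) + (1 - t) * fine (zeta y).
Proof.
move=> fx fy t01; have [gtNy _ cz _] := hzeta.
have := cz x y t fx.1 fy.1 t01.
rewrite -(fineK_feasible fx) -(fineK_feasible fy) -!EFinM -EFinD => zt.
have ft : feasible (t *: x + (1 - t) *: y).
  split; first exact: convex_setE fx.1 fy.1 t01.
  exact: le_lt_trans zt (ltry _).
by split=> //; rewrite -lee_fin (fineK_feasible ft).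
Qed.

(** Passage from extended-real minimisation over U to real minimisation over
the feasible points. *)
Lemma is_argmin_feasible (f : E -> \bar R) (phi : E -> R) (z : E) :
  (forall x, feasible x -> f x = (phi x)%:E) ->
  (forall x, U x -> ~ edom zeta x -> f x = +oo%E) ->
  is_argmin U f z -> feasible z /\ forall x, feasible x -> phi z <= phi x.
Proof.
move=> fE foo [Uz zmin].
have fz : feasible z.
  split=> //; apply: contrapT => /(foo _ Uz) fzoo.
  have [x fx] := feasible_nonempty.
  by have := zmin x fx.1; rewrite fzoo (fE x fx) leye_eq.
split=> // x fx; have := zmin x fx.1.
by rewrite (fE _ fz) (fE _ fx) lee_fin.
Qed.

(** The strong convexity inequality between u and x, divided by the step and
passed to the limit at u. *)
Lemma rbregman_ge x u : U x -> dgf_int U omega u ->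
  `|x - u| ^+ 2 / 2 <= rbregman x u.
Proof.
case: homega => _ _ _ sc [dom _ _] Ux [Uu /dom du].
suff : egrad omega u (x - u) <=
    fine (omega x) - fine (omega u) - `|x - u| ^+ 2 / 2.
  by rewrite /rbregman; lra.
apply: (grad_le (c := `|x - u| ^+ 2 / 2) du) => l /andP[l0 l1] /=.
have -> : u + l *: (x - u) = l *: x + (1 - l) *: u.
  by rewrite scalerBr scalerBl scale1r addrCA addrC.
have := sc x u l Ux Uu; rewrite (ltW l0) l1 => /(_ isT) /=; lra.
Qed.

(** The optimality of ubar along the segment towards x bounds the difference
quotient of omega at ubar from below; in the limit this is the first-order
optimality condition, and expanding the three Bregman distances gives the
claim. *)
Lemma three_point (phi : E -> R) (c : R) (u0 ubar x : E) :
  (forall x y (t : R), feasible x -> feasible y -> 0 <= t <= 1 ->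
    phi (t *: x + (1 - t) *: y) <= t * phi x + (1 - t) * phi y) ->
  0 < c -> (edom omega)° ubar -> feasible ubar ->
  (forall y, feasible y ->
    phi ubar + c * rbregman ubar u0 <= phi y + c * rbregman y u0) ->
  feasible x ->
  phi ubar + c * rbregman ubar u0 + c * rbregman x ubar <=
    phi x + c * rbregman x u0.
Proof.
move=> cphi c0 iu fu umin fx.
have [_ _ _ _ [/(_ _ iu) du _ _]] := homega.
suff : egrad omega u0 (x - ubar) + (phi ubar - phi x) / c <=
    egrad omega ubar (x - ubar).
  rewrite -lerBrDl ler_pdivrMr // /rbregman.
  have -> : x - u0 = (x - ubar) + (ubar - u0) by rewrite addrA subrK.
  have -> : egrad omega u0 ((x - ubar) + (ubar - u0)) =
      egrad omega u0 (x - ubar) + egrad omega u0 (ubar - u0) by exact: linearD.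
  lra.
apply: (grad_ge du) => l /andP[l0 l1] /=.
have xlE : ubar + l *: (x - ubar) = l *: x + (1 - l) *: ubar.
  by rewrite scalerBr scalerBl scale1r addrCA addrC.
have l01 : 0 <= l <= 1 by rewrite (ltW l0).
have [fl _] := feasible_convex fx fu l01.
have := umin _ fl; have := cphi _ _ _ fx fu l01.
rewrite -xlE /rbregman.
have -> : ubar + l *: (x - ubar) - u0 = l *: (x - ubar) + (ubar - u0).
  by rewrite addrA [ubar + _]addrC.
have -> : egrad omega u0 (l *: (x - ubar) + (ubar - u0)) =
    l * egrad omega u0 (x - ubar) + egrad omega u0 (ubar - u0).
  by rewrite linearD linearZ.
move=> h1 h2.
rewrite -(ler_pM2l c0).
have -> : c * (l * (egrad omega u0 (x - ubar) + (phi ubar - phi x) / c)) =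
  l * (c * egrad omega u0 (x - ubar) + (phi ubar - phi x)) by field; lra.
lra.
Qed.

(** Up to a constant and the factor a, the objective is that of a prox problem
with linear part (xi - c grad omega(u0)) / a and step a / c, whose unique
solution lies in the interior of dom omega. *)
Lemma prox_interior (xi : 'Hom(E, R^o)) (a c : R) (u0 ubar : E) :
  0 < a -> 0 < c -> feasible ubar ->
  (forall y, feasible y ->
    xi ubar + a * fine (zeta ubar) + c * rbregman ubar u0 <=
    xi y + a * fine (zeta y) + c * rbregman y u0) ->
  (edom omega)° ubar.
Proof.
move=> a0 c0 fu umin; have [_ _ _ hprox] := hzeta.
have ac0 : 0 < a / c by rewrite divr_gt0.
have [v [_ [_ iv] _ vuniq]] := hprox (a^-1 *: (xi - c *: egrad omega u0)) _ ac0.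
suff -> : ubar = v by [].
apply: vuniq; split; first exact: fu.1.
move=> y Uy /=; have [zy|/notin_edom ->] := pselect (edom zeta y); last first.
  by rewrite -(fineK_dgf Uy) -EFinM !addye ?leey.
have fy : feasible y by [].
rewrite -(fineK_feasible fu) -(fineK_feasible fy).
rewrite -(fineK_dgf fu.1) -(fineK_dgf Uy).
rewrite -!EFinM -!EFinD lee_fin -(ler_pM2l a0) !mulrDr.
rewrite !scale_lfunE !add_lfunE !opp_lfunE !scale_lfunE.
have := umin y fy; rewrite /rbregman !linearB /= /GRing.scale /=.
have aV t : a * (a^-1 * t) = t by rewrite mulrA divff ?gt_eqF ?mul1r.
have acV t : a * ((a / c)^-1 * t) = c * t by field; rewrite !gt_eqF.
rewrite !mulrBr !aV !acV; lra.
Qed.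

End ProxStep.

(** * Weights and weighted means *)

Section WeightSum.
Context {R : realType}.
Variable alpha : nat -> R.

Lemma weight_sum0 : weight_sum alpha 0 = alpha 0%N.
Proof. by rewrite /weight_sum big_ord1. Qed.

Lemma weight_sumS t :
  weight_sum alpha t.+1 = weight_sum alpha t + alpha t.+1.
Proof. by rewrite /weight_sum big_ord_recr. Qed.

Lemma weight_sum_gt0 t : (forall i, 0 < alpha i) -> 0 < weight_sum alpha t.
Proof.
by move=> a0; elim: t => [|t IH]; rewrite ?weight_sum0 // weight_sumS addr_gt0.
Qed.

End WeightSum.

Section Weights.
Context {R : realType}.
Variable alpha : nat -> R.
Hypotheses (alpha0 : alpha 0%N = 1)
  (alphaS : forall t, (1 <= t)%N -> alpha t = (2 * t%:R + 3) / 4).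

Lemma apg_weight_sumE t : weight_sum alpha t = t.+2%:R ^+ 2 / 4.
Proof.
elim: t => [|t IH]; first by rewrite weight_sum0 alpha0; field.
rewrite weight_sumS IH alphaS // -[t.+3%:R]natr1 -[t.+2%:R]natr1 -natr1.
by field.
Qed.

Lemma apg_weight_gt0 t : 0 < alpha t.
Proof.
by case: t => [|t]; rewrite ?alpha0 // alphaS // divr_gt0 // ltr_wpDl.
Qed.

Lemma apg_weight_sqr t : alpha t ^+ 2 <= weight_sum alpha t.
Proof.
case: t => [|t]; first by rewrite weight_sum0 alpha0 expr1n.
rewrite apg_weight_sumE alphaS // -[t.+3%:R]natr1 -[t.+2%:R]natr1 -natr1.
have : 0 <= t%:R :> R by [].
nra.
Qed.

Lemma apg_weighted_errorE (delta : nat -> R) t :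
  (\sum_(i < t.+1) weight_sum alpha i * delta i) / weight_sum alpha t =
  (\sum_(i < t.+1) i.+2%:R ^+ 2 * delta i) / t.+2%:R ^+ 2.
Proof.
have -> : \sum_(i < t.+1) weight_sum alpha i * delta i =
    (\sum_(i < t.+1) i.+2%:R ^+ 2 * delta i) / 4.
  rewrite mulr_suml; apply: eq_bigr => i _; rewrite apg_weight_sumE; ring.
by rewrite apg_weight_sumE; field.
Qed.

End Weights.

(** Jensen's inequality, by induction along the running means. *)
Lemma weighted_mean_concave (R : realType) (F : finNormedModType R) (V : set F)
    (f : F -> R) (alpha : nat -> R) (v : nat -> F) (t : nat) :
  convex_set V -> strongly_concave_on 0 V f ->
  (forall i, 0 < alpha i) -> (forall i, V (v i)) ->
  let vbar := (weight_sum alpha t)^-1 *: \sum_(i < t.+1) alpha i *: v i in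
  V vbar /\ \sum_(i < t.+1) alpha i * f (v i) <= weight_sum alpha t * f vbar.
Proof.
move=> cV cf a0 Vv /=.
have A0 n : 0 < weight_sum alpha n by exact: weight_sum_gt0.
elim: t => [|t [Vt ft]].
  rewrite /weight_sum !big_ord1 scalerA mulVf ?gt_eqF // scale1r.
  by split.
set y := _ *: _ in Vt ft.
have AS := weight_sumS alpha t.
have A'0 := A0 t.+1; rewrite AS in A'0.
have a1 := a0 t.+1; have At := A0 t.
set l := alpha t.+1 / (weight_sum alpha t + alpha t.+1).
have l01 : 0 <= l <= 1.
  by rewrite /l divr_ge0 ?ler_pdivrMr ?mul1r //=; lra.
have lE : 1 - l = weight_sum alpha t / (weight_sum alpha t + alpha t.+1).
  by rewrite /l; field; lra.
have -> : (weight_sum alpha t.+1)^-1 *: \sum_(i < t.+2) alpha i *: v i =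
    l *: v t.+1 + (1 - l) *: y.
  rewrite big_ord_recr /= AS lE /y scalerDr !scalerA addrC.
  by congr (_ *: _ + _ *: _); rewrite /l; field; lra.
split; first exact: convex_setE.
rewrite big_ord_recr /= AS.
have := cf _ _ _ (Vv t.+1) Vt l01.
rewrite mul0r mul0r subr0 => cfl.
have : l * f (v t.+1) + (1 - l) * f y <= f (l *: v t.+1 + (1 - l) *: y) by lra.
move=> /(ler_wpM2l (ltW A'0)); apply: le_trans.
have -> : (weight_sum alpha t + alpha t.+1) * (l * f (v t.+1) + (1 - l) * f y) =
   alpha t.+1 * f (v t.+1) + weight_sum alpha t * f y.
  by rewrite lE /l; field; lra.
by rewrite addrC lerD2l.
Qed.

(** * The accelerated method *)

(** Independent of any oracle bound: this is what allows
[max_structure_FOA] to be applied at the iterates. *)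
Lemma apg_iterates_in (R : realType) (E : finNormedModType R) (U : set E)
    (omega zeta : E -> \bar R) (mu Lbar : R) (alpha : nat -> R)
    (ghat s : nat -> 'Hom(E, R^o)) (u ubar w z : nat -> E) :
  convex_set U -> (forall t, 0 < alpha t) ->
  apg_iterates U omega zeta mu Lbar alpha ghat s u ubar w z ->
  forall t, U (u t) /\ U (z t).
Proof.
move=> /convex_setE cU a0 it.
have tau01 t : 0 <= weight_ratio alpha t.+1 <= 1.
  rewrite /weight_ratio; apply/andP; split.
    by rewrite divr_ge0 // ltW // weight_sum_gt0.
  rewrite ler_pdivrMr ?weight_sum_gt0 // mul1r weight_sumS lerDr.
  by rewrite ltW // weight_sum_gt0.
elim=> [|t [_ Uz]]; first by split; [exact: (apg_u0 it).1|exact: (apg_z0 it).1].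
rewrite (apg_u it) (apg_z it) ![_ + weight_ratio _ _ *: _]addrC.
by split; apply: cU => //; [exact: (apg_ubar it t).1|exact: (apg_w it t).1].
Qed.

Section APG.
Context {R : realType} {E : finNormedModType R}.
Variables (U : set E) (omega zeta : E -> \bar R) (h : E -> R).
Hypotheses (Uconvex : convex_set U) (homega : is_dgf U omega).
Hypothesis hzeta : is_simple U omega zeta.
Variables (alpha delta : nat -> R) (Lbar : R).
Hypotheses (alpha0 : alpha 0%N = 1) (alpha_gt0 : forall t, 0 < alpha t).
Hypothesis alpha_sqr : forall t, alpha t ^+ 2 <= weight_sum alpha t.
Hypothesis Lbar0 : 0 <= Lbar.
Variables (hhat : nat -> R) (ghat s : nat -> 'Hom(E, R^o)).
Variables (u ubar w z : nat -> E).
Hypothesis run : apg_iterates U omega zeta 0 Lbar alpha ghat s u ubar w z.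
Hypothesis hFOA : forall t, is_FOA U h (delta t) Lbar (u t) (hhat t) (ghat t).

Local Notation feas := (feasible U zeta).
Local Notation zr x := (fine (zeta x)).
Local Notation A_ := (weight_sum alpha).
Local Notation D := (rbregman omega).

(** The oracle's lower bounds make this a minorant of A_t (h + zeta) on U; it
differs from a multiple of zeta by an affine function, so minimising it with a
Bregman term is a prox problem. *)
Definition lower_model t (x : E) : R :=
  \sum_(i < t.+1) alpha i * (hhat i + ghat i (x - u i) + zr x).

Lemma lower_modelS t x : lower_model t.+1 x = lower_model t x +
  alpha t.+1 * (hhat t.+1 + ghat t.+1 (x - u t.+1) + zr x).
Proof. by rewrite /lower_model big_ord_recr. Qed.

(** Differences remove the constants, which do not appear in the objective
that ubar_(t+1) minimises. *)
Lemma lower_modelB t x y : lower_model t x - lower_model t y =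
  (s t x + A_ t * zr x) - (s t y + A_ t * zr y).
Proof.
elim: t => [|t IH].
  rewrite /lower_model !big_ord1 weight_sum0 alpha0 (apg_s0 run).
  rewrite !linearB /=; lra.
rewrite !lower_modelS weight_sumS (apg_s run) !add_lfunE !scale_lfunE.
rewrite !linearB /= /GRing.scale /=; lra.
Qed.

Lemma z0_argmin : feas (z 0) /\ forall x, feas x ->
  s 0 (z 0) + zr (z 0) + Lbar * D (z 0) (u 0) <=
  s 0 x + zr x + Lbar * D x (u 0).
Proof.
have Uu0 := (apg_u0 run).1.
apply: (is_argmin_feasible (phi := fun x =>
  s 0 x + zr x + Lbar * D x (u 0)) hzeta _ _ (apg_z0 run)) => [x fx|x Ux zx] /=.
  by rewrite mul0e adde0 (bregmanE homega fx.1 Uu0) -(fineK_feasible hzeta fx)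
    -EFinM -!EFinD.
by rewrite mul0e adde0 (bregmanE homega Ux Uu0) (notin_edom zx) addey // addye.
Qed.

Lemma ubar_argmin t : feas (ubar t.+1) /\ forall x, feas x ->
  s t (ubar t.+1) + A_ t * zr (ubar t.+1) + Lbar * D (ubar t.+1) (u 0) <=
  s t x + A_ t * zr x + Lbar * D x (u 0).
Proof.
have Uu0 := (apg_u0 run).1.
apply: (is_argmin_feasible (phi := fun x =>
  s t x + A_ t * zr x + Lbar * D x (u 0)) hzeta _ _ (apg_ubar run t))
  => [x fx|x Ux zx] /=.
  by rewrite mul0e adde0 (bregmanE homega fx.1 Uu0) -(fineK_feasible hzeta fx)
    -!EFinM -!EFinD.
rewrite mul0e adde0 (bregmanE homega Ux Uu0) (notin_edom zx).
by rewrite gt0_muley ?lte_fin ?weight_sum_gt0 // addey // addye.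
Qed.

Lemma w_argmin t : feas (w t.+1) /\ forall x, feas x ->
  alpha t.+1 * (ghat t.+1 (w t.+1) + zr (w t.+1))
    + Lbar * D (w t.+1) (ubar t.+1) <=
  alpha t.+1 * (ghat t.+1 x + zr x) + Lbar * D x (ubar t.+1).
Proof.
have [fu _] := ubar_argmin t.
apply: (is_argmin_feasible (phi := fun x =>
  alpha t.+1 * (ghat t.+1 x + zr x) + Lbar * D x (ubar t.+1)) hzeta _ _
  (apg_w run t)) => [x fx|x Ux zx] /=.
  by rewrite mul0e adde0 mulr0 add0r (bregmanE homega fx.1 fu.1)
    -(fineK_feasible hzeta fx) [RHS]EFinD !EFinM EFinD.
rewrite mul0e adde0 mulr0 add0r (bregmanE homega Ux fu.1) (notin_edom zx).
by rewrite addey // gt0_muley ?lte_fin // addye.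
Qed.

(** For Lbar = 0 the minimiser may fall outside the interior of dom omega, but
then the Bregman terms vanish and plain minimality is enough. *)
Lemma ubar_three_point t x : feas x ->
  s t (ubar t.+1) + A_ t * zr (ubar t.+1) + Lbar * D (ubar t.+1) (u 0)
    + Lbar * D x (ubar t.+1) <= s t x + A_ t * zr x + Lbar * D x (u 0) /\
  Lbar / 2 * `|x - ubar t.+1| ^+ 2 <= Lbar * D x (ubar t.+1).
Proof.
move=> fx; have [fu umin] := ubar_argmin t.
have [L0|Lneq0] := eqVneq Lbar 0.
  by have := umin _ fx; rewrite L0 !mul0r !addr0.
have Lgt0 : 0 < Lbar by rewrite lt_neqAle eq_sym Lneq0.
have iu := prox_interior homega hzeta (weight_sum_gt0 t alpha_gt0) Lgt0 fu umin.
split.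
  apply: (three_point Uconvex homega hzeta
    (phi := fun x => s t x + A_ t * zr x)) => //.
  move=> y y' l fy fy' l01 /=.
  have [_ zl] := feasible_convex Uconvex hzeta fy fy' l01.
  have := ler_wpM2l (ltW (weight_sum_gt0 t alpha_gt0)) zl.
  rewrite linearD !linearZ /= /GRing.scale /=; lra.
have := rbregman_ge homega fx.1 (conj fu.1 iu).
by move=> /(ler_wpM2l Lbar0); lra.
Qed.

(** Inductive step: add the upper oracle bound at z_(t+1), split along
z_(t+1) = (1 - tau) z_t + tau w_(t+1), use the lower oracle bound at z_t and
the invariant at x = ubar_(t+1), then [ubar_three_point] at x, and finally the
minimality of w_(t+1) against x. *)
Lemma apg_estimate t : feas (z t) /\ forall x, feas x ->
  A_ t * (h (z t) + zr (z t)) <=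
  lower_model t x + Lbar * D x (u 0) + \sum_(i < t.+1) A_ i * delta i.
Proof.
elim: t => [|t [fz IH]].
  have [fz zmin] := z0_argmin; split=> // x fx.
  have /andP[_ h0] := hFOA 0 fz.1.
  have := rbregman_ge homega fz.1 (apg_u0 run) => /(ler_wpM2l Lbar0) D0.
  have := zmin _ fx; have := lower_modelB 0 x (z 0).
  rewrite {2}/lower_model !big_ord1 weight_sum0 alpha0; lra.
have [fu _] := ubar_argmin t; have [fw wmin] := w_argmin t.
set a := alpha t.+1 in wmin *; set A := A_ t in IH *.
have a0 : 0 < a by exact: alpha_gt0.
have A0 : 0 < A by exact: weight_sum_gt0.
have A'E : A_ t.+1 = A + a by exact: weight_sumS.
have zS := apg_z run t; have uS := apg_u run t.
have tauE : weight_ratio alpha t.+1 = a / (A + a) by rewrite /weight_ratio A'E.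
move: (weight_ratio alpha t.+1) tauE zS uS => tau tauE zS uS.
have AtauE : (A + a) * tau = a by rewrite tauE; field; lra.
have tau0 : 0 <= tau by rewrite tauE divr_ge0 //; lra.
have tau1 : tau <= 1 by rewrite tauE ler_pdivrMr; lra.
have t01 : 0 <= tau <= 1 by rewrite tau0.
have zE : z t.+1 = tau *: w t.+1 + (1 - tau) *: z t.
  by rewrite zS addrC.
have [fz' zz'] := feasible_convex Uconvex hzeta fw fz t01.
rewrite -zE in fz' zz'; split=> // x fx.
have dzE : z t.+1 - u t.+1 = tau *: (w t.+1 - ubar t.+1).
  by rewrite zS uS opprD addrACA subrr add0r scalerBr.
have gE : ghat t.+1 (z t.+1 - u t.+1) =
    tau * ghat t.+1 (w t.+1 - u t.+1) + (1 - tau) * ghat t.+1 (z t - u t.+1).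
  rewrite zE !linearB linearD !linearZ /= /GRing.scale /=; ring.
have /andP[_ hz'] := hFOA t.+1 fz'.1.
have /andP[hz _] := hFOA t.+1 fz.1.
have [tpx _] := ubar_three_point t fx.
have [_ qw] := ubar_three_point t fw.
have wx := wmin _ fx; have IHu := IH _ fu.
have mB := lower_modelB t x (ubar t.+1).
have a2 := alpha_sqr t.+1; rewrite A'E -/a in a2.
rewrite gE dzE normrZ ger0_norm // exprMn in hz'.
set N := `|_| ^+ 2 in hz' qw.
have N0 : 0 <= N by exact: sqr_ge0.
(* This is where alpha_(t+1)^2 <= A_(t+1) enters. *)
have quad : (A + a) * (Lbar / 2 * (tau ^+ 2 * N)) <= Lbar / 2 * N.
  have -> : (A + a) * (Lbar / 2 * (tau ^+ 2 * N)) =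
      (((A + a) * tau) ^+ 2 / (A + a)) * (Lbar / 2 * N) by field; lra.
  rewrite AtauE ler_piMl //; first by rewrite mulr_ge0 // divr_ge0.
  by rewrite ler_pdivrMr ?mul1r //; lra.
rewrite lower_modelS big_ord_recr /= A'E -/a.
have Aa0 : 0 <= A + a by lra.
have hz'A := ler_wpM2l Aa0 hz'; have zz'A := ler_wpM2l Aa0 zz'.
have hzA := ler_wpM2l (ltW A0) hz.
rewrite !linearB /= in gE hz'A hzA *.
have e1 : (A + a) * (hhat t.+1
      + (tau * (ghat t.+1 (w t.+1) - ghat t.+1 (u t.+1))
         + (1 - tau) * (ghat t.+1 (z t) - ghat t.+1 (u t.+1)))
      + Lbar / 2 * (tau ^+ 2 * N) + delta t.+1) =
    A * (hhat t.+1 + (ghat t.+1 (z t) - ghat t.+1 (u t.+1)))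
    + a * (hhat t.+1 + (ghat t.+1 (w t.+1) - ghat t.+1 (u t.+1)))
    + (A + a) * (Lbar / 2 * (tau ^+ 2 * N)) + (A + a) * delta t.+1.
  by rewrite tauE; field; lra.
have e2 : (A + a) * (tau * zr (w t.+1) + (1 - tau) * zr (z t)) =
    a * zr (w t.+1) + A * zr (z t).
  by rewrite tauE; field; lra.
rewrite e2 in zz'A; rewrite e1 in hz'A.
lra.
Qed.

End APG.

(** * The Bregman radius and the objective *)

Section Radius.
Context {R : realType} {E : finNormedModType R}.
Variables (U : set E) (omega : E -> \bar R).
Hypothesis homega : is_dgf U omega.

(** Since u0 is interior to dom omega, the linear part of the Bregman distance
is continuous. *)
Lemma dgf_radius_attained u0 :
  closed U -> bounded_set U -> dgf_int U omega u0 ->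
  exists2 x, U x & dgf_radius U omega u0 = (rbregman omega x u0)%:E.
Proof.
move=> Ucl Ubd [Uu0 iu0]; have [_ _ co _ [/(_ _ iu0) du0 _ _]] := homega.
have cD : {within U, continuous (rbregman omega ^~ u0 : E -> R)}.
  move=> x; apply: cvgB; first by apply: cvgB; [exact: co|exact: cvg_cst].
  have cg : continuous (fun x : E => egrad omega u0 (x - u0)).
    move=> y; apply: (@continuous_comp _ _ _ (fun x : E => x - u0)).
      by apply: cvgB; [exact: cvg_id|exact: cvg_cst].
    exact: (grad_continuous du0).
  exact: (continuous_subspaceT cg).
have [x /set_mem Ux xmax] := compact_EVT_max (ex_intro _ u0 Uu0)
  (fin_bounded_closed_compact Ubd Ucl) cD.
exists x => //; apply/eqP; rewrite eq_le; apply/andP; split.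
  apply: ge_ereal_sup => _ [y Uy <-].
  by rewrite (bregmanE homega Uy Uu0) lee_fin; apply: xmax; exact: mem_set.
apply: ereal_sup_ubound; exists x => //.
exact: (bregmanE homega Ux Uu0).
Qed.

End Radius.

Lemma objectiveE (R : realType) (E : finNormedModType R) (U : set E)
    (omega zeta : E -> \bar R) (f : E -> R) (x : E) :
  is_simple U omega zeta -> feasible U zeta x ->
  objective omega zeta 0 f x = (f x + fine (zeta x))%:E.
Proof.
by move=> hz fx; rewrite /objective mul0e adde0 -(fineK_feasible hz fx) -EFinD.
Qed.

Lemma objective_infeasible (R : realType) (E : finNormedModType R)
    (omega zeta : E -> \bar R) (f : E -> R) (x : E) :
  ~ edom zeta x -> objective omega zeta 0 f x = +oo%E.
Proof. by move=> /notin_edom zx; rewrite /objective mul0e adde0 zx addey. Qed.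

Theorem theorem5p1 (R : realType) (E : finNormedModType R) (U U' : set E)
  (omega zeta : E -> \bar R) (h : E -> R) (mu : R) (ustar : E)
  (delta alpha : nat -> R)
  (U0 : U !=set0) (Uclosed : closed U) (Uconvex : convex_set U)
  (homega : is_dgf U omega)
  (hconvex : convex_function U h)
  (U'open : open U') (UU' : U `<=` U')
  (hdiff : forall u, U' u -> differentiable (h : E -> R) u)
  (hzeta : is_simple U omega zeta)
  (hmu : mu = 0)
  (ustar_int : dgf_int U omega ustar)
  (ustar_opt : is_argmin U (objective omega zeta mu h) ustar)
  (delta_ge0 : forall t, 0 <= delta t)
  (alpha0 : alpha 0%N = 1)
  (alphaS : forall t, (1 <= t)%N -> alpha t = (2 * t%:R + 3) / 4) :
  (forall (Lh Lbar : R) (hhat : nat -> R) (ghat s : nat -> 'Hom(E, R^o))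
      (u ubar w z : nat -> E),
    0 <= Lh -> grad_lipschitz_on U h Lh -> Lh <= Lbar ->
    apg_iterates U omega zeta mu Lbar alpha ghat s u ubar w z ->
    (forall t, is_FOA U h (delta t) Lbar (u t) (hhat t) (ghat t)) ->
    forall t,
      (objective omega zeta mu h (z t) - opt_value U omega zeta mu h <=
       (4 * Lbar / t.+2%:R ^+ 2)%:E * bregman omega ustar (u 0%N)
       + ((\sum_(i < t.+1) i.+2%:R ^+ 2 * delta i) / t.+2%:R ^+ 2)%:E)%E)
  /\
  (forall (F : finNormedModType R) (V V' : set F) (Psi : E -> F -> R)
      (rho Luu Luv : R) (s : nat -> 'Hom(E, R^o)) (u ubar w z : nat -> E)
      (v : nat -> F),
    let Lh := Luu + Luv ^+ 2 / rho in
    let ghat t := grad (Psi^~ (v t)) (u t) in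
    let vbar t :=
      (weight_sum alpha t)^-1 *: \sum_(i < t.+1) alpha i *: v i in
    max_structure U U' V V' h Psi rho Luu Luv ->
    bounded_set U ->
    (forall t, V (v t)) ->
    (forall t, h (u t) - Psi (u t) (v t) <= delta t / 2) ->
    apg_iterates U omega zeta mu (2 * Lh) alpha ghat s u ubar w z ->
    [/\ forall t,
          is_FOA U h (delta t) (2 * Lh) (u t) (Psi (u t) (v t)) (ghat t),
        exists2 x, U x & bregman omega x (u 0%N) = dgf_radius U omega (u 0%N),
        (dgf_radius U omega (u 0%N) < +oo)%E
      & forall t,
        (duality_gap U omega zeta mu h Psi (z t) (vbar t) <=
         (8 * Lh / t.+2%:R ^+ 2)%:E * dgf_radius U omega (u 0%N)
         + ((\sum_(i < t.+1) i.+2%:R ^+ 2 * delta i) / t.+2%:R ^+ 2)%:E)%E]).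
Proof.
subst mu.
have a_gt0 := apg_weight_gt0 alpha0 alphaS.
have a_sqr := apg_weight_sqr alpha0 alphaS.
split.
  move=> Lh Lbar hhat ghat s u ubar w z Lh0 _ LhLbar it foa t.
  have Lbar0 : 0 <= Lbar by exact: le_trans LhLbar.
  have [fz est] := apg_estimate Uconvex homega hzeta alpha0 a_gt0 a_sqr
    Lbar0 it foa t.
  have [fs _] := is_argmin_feasible hzeta
    (fun x => objectiveE h hzeta (x := x))
    (fun x _ => objective_infeasible omega h (x := x)) ustar_opt.
  have -> : opt_value U omega zeta 0 h = objective omega zeta 0 h ustar.
    apply/eqP; rewrite eq_le; apply/andP; split.
      by apply: ereal_inf_lbound; exists ustar => //; exact: ustar_int.1.
    by apply: le_ereal_inf_tmp => _ [x Ux <-]; exact: ustar_opt.2.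
  rewrite (objectiveE _ hzeta fz) (objectiveE _ hzeta fs).
  rewrite (bregmanE homega ustar_int.1 (apg_u0 it).1).
  rewrite -EFinN -EFinM -!EFinD lee_fin.
  have low : lower_model zeta alpha hhat ghat u t ustar <=
      weight_sum alpha t * (h ustar + fine (zeta ustar)).
    rewrite /weight_sum mulr_suml; apply: ler_sum => i _.
    rewrite (ler_wpM2l (ltW (a_gt0 i))) // lerD2r.
    by have /andP[] := foa i _ ustar_int.1.
  have At0 := weight_sum_gt0 t a_gt0.
  have AE := apg_weight_sumE alpha0 alphaS t.
  rewrite -(apg_weighted_errorE alpha0 alphaS).
  have -> : 4 * Lbar / t.+2%:R ^+ 2 = Lbar / weight_sum alpha t.
    by rewrite AE; field.
  rewrite mulrAC -mulrDl ler_pdivlMr //.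
  have := est _ fs; lra.
move=> F V V' Psi rho Luu Luv s u ubar w z v Lh ghat vbar ms Ubd Vv hv it.
have Lh0 : 0 <= Lh.
  by rewrite addr_ge0 ?divr_ge0 ?sqr_ge0 ?(ms_Luu0 ms) // ltW // (ms_rho0 ms).
have Uit := apg_iterates_in Uconvex a_gt0 it.
have foa t : is_FOA U h (delta t) (2 * Lh) (u t) (Psi (u t) (v t)) (ghat t).
  exact: (max_structure_FOA UU' ms (Uit t).1 (Vv t) (hv t)).
have [xm Uxm radE] := dgf_radius_attained homega Uclosed Ubd (apg_u0 it).
have Uu0 := (apg_u0 it).1.
split=> //.
- by exists xm => //; rewrite radE (bregmanE homega Uxm Uu0).
- by rewrite radE ltry.
move=> t.
have Lbar0 : 0 <= 2 * Lh by rewrite mulr_ge0.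
have [fz est] := apg_estimate Uconvex homega hzeta alpha0 a_gt0 a_sqr
  Lbar0 it foa t.
have At0 := weight_sum_gt0 t a_gt0.
have AE := apg_weight_sumE alpha0 alphaS t.
(* A lower bound on the dual function, as an infimum over U, bounds the gap. *)
rewrite /duality_gap radE (objectiveE _ hzeta fz) -EFinM -EFinD.
set c := _ + (_ / _); set P := h (z t) + _.
suff dual_ge : ((P - c)%:E <= dual_function U omega zeta 0 Psi (vbar t))%E.
  apply: (le_trans (leeB (lexx _) dual_ge)).
  by rewrite -EFinB lee_fin opprB addrC subrK.
apply: le_ereal_inf_tmp => _ [x Ux <-].
have [zx|zx] := pselect (edom zeta x); last first.
  by rewrite objective_infeasible // leey.
have fx : feasible U zeta x by [].
rewrite (objectiveE _ hzeta fx) lee_fin.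
have xu0 : rbregman omega x (u 0%N) <= rbregman omega xm (u 0%N).
  rewrite -lee_fin -radE -(bregmanE homega Ux Uu0).
  by apply: ereal_sup_ubound; exists x.
have low : lower_model zeta alpha (fun i => Psi (u i) (v i)) ghat u t x <=
    \sum_(i < t.+1) alpha i * Psi x (v i)
    + weight_sum alpha t * fine (zeta x).
  rewrite /weight_sum mulr_suml -big_split /=; apply: ler_sum => i _.
  rewrite -mulrDr (ler_wpM2l (ltW (a_gt0 i))) // lerD2r.
  exact: (grad_convex_le (ms_diff ms (Vv i) (UU' _ (Uit i).1))
    (ms_convex ms (Vv i)) (Uit i).1 Ux).
have conc0 : strongly_concave_on 0 V (Psi x).
  move=> y y' l Vy Vy' l01; apply: le_trans (ms_concave ms Ux Vy Vy' l01) _.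
  rewrite lerD2l lerN2 mul0r mul0r mulr_ge0 ?divr_ge0 ?(ltW (ms_rho0 ms)) //.
  by case/andP: l01 => l0 l1; rewrite !mulr_ge0 ?subr_ge0 ?sqr_ge0.
have [_ jensen] := weighted_mean_concave t (ms_Vconvex ms) conc0 a_gt0 Vv.
have {xu0} Dle := ler_wpM2l Lbar0 xu0.
have cE : c = (2 * Lh * rbregman omega xm (u 0%N)
    + \sum_(i < t.+1) weight_sum alpha i * delta i) / weight_sum alpha t.
  rewrite mulrDl (apg_weighted_errorE alpha0 alphaS) /c AE.
  by congr (_ + _); field.
rewrite lerBlDr cE -lerBlDl ler_pdivlMr //.
have := est _ fx; rewrite -/P -/(vbar t) in jensen *; lra.
Qed.
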